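(* Let $n$ be a positive integer. If $n$ is odd, then for any given positive integers $q_3$ and $q_2$ and any residue $a_3$ modulo $q_3$ with $(a_3,q_3)=1$ there exists an admissible residue $a_2$ modulo $q_2$ (so that for every positive integer $q_1$ there exists an admissible residue $a_1$ modulo $q_1$). If $n$ is even, then for any given positive integers $q_1,q_2,q_3$ there exists no admissible triplet $a_1,a_2,a_3$.
   Context: The $q_i\ge1$ are integers and residues are taken with $0\le a_i<q_i$. Round brackets denote greatest common divisors and square brackets least common multiples; $\varphi$ is Euler's function, $e(\alpha)=e^{2\pi i\alpha}$. Singular series. Given $n$ and $a_i,q_i$ with $(a_i,q_i)=1$ ($i=1,2,3$): for $j=1,2,3$, an integer $q\ge1$ and $(a,q)=1$ put $$c_j(a,q)=\sum_{\substack{1\le k\le q\\(k,q)=1\\k\equiv a_j\ (\mathrm{mod}\ (q,q_j))}}e\!\left(\frac{a}{q}k\right),\qquad b(q)=\sum_{\substack{0\le a<q\\(a,q)=1}}c_1(a,q)c_2(a,q)c_3(a,q)\,e\!\left(-n\frac aq\right),$$ $$\lambda(q)=\frac{\varphi(q_1)\varphi(q_2)\varphi(q_3)}{\varphi([q_1,q])\varphi([q_2,q])\varphi([q_3,q])}\,b(q).$$ (For $q=1$ the value $a=0$ is used, so $b(1)=\lambda(1)=1$.) If $n\equiv a_1+a_2+a_3\pmod{(q_1,q_2,q_3)}$, set $\mathcal{S}_3(n)=\sum_{q=1}^{\infty}\lambda(q)$ (this series converges absolutely); otherwise set $\mathcal{S}_3(n)=0$. Admissibility. For given $q_1,q_2,q_3$,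 a triplet $a_1,a_2,a_3$ of residues mod $q_1,q_2,q_3$ is called admissible for $q_1,q_2,q_3$ if $(a_i,q_i)=1$ for $i=1,2,3$, $n\equiv a_1+a_2+a_3\pmod{(q_1,q_2,q_3)}$ and $\mathcal{S}_3(n)>0$. For given $q_3,a_3,q_2,a_2$ and $q_1$, a residue $a_1$ is called admissible if the triplet $a_1,a_2,a_3$ is admissible for $q_1,q_2,q_3$. For given $q_3,a_3,q_2$, a residue $a_2$ is called admissible if for every positive integer $q_1$ there exists an admissible $a_1$. *)

(* Defs.v *)
From HB Require Import structures.
From mathcomp Require Import all_boot all_order all_algebra.
From mathcomp Require Import complex.
From mathcomp Require Import all_classical all_reals all_analysis.

Set Implicit Arguments.
Unset Strict Implicit.
Unset Printing Implicit Defensive.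

Import Order.TTheory GRing.Theory Num.Theory numFieldNormedType.Exports.

Local Open Scope classical_set_scope.
Local Open Scope ring_scope.
Local Open Scope complex_scope.

(* The values lie in [R[i]^o] rather than [R[i]]: only the former carries the
   topology induced by the complex modulus. *)
Definition e2pi (R : realType) (alpha : R) : R[i]^o :=
  cos (2 * pi * alpha) +i* sin (2 * pi * alpha).

(* [sing_c R qj aj q a] is c_j(a,q). *)
Definition sing_c (R : realType) (qj aj q a : nat) : R[i]^o :=
  \sum_(1 <= k < q.+1 | coprime k q && (k == aj %[mod gcdn q qj])%N)
    e2pi (a%:R / q%:R * k%:R : R).

Definition sing_b (R : realType) (n q1 q2 q3 a1 a2 a3 q : nat) : R[i]^o :=
  \sum_(0 <= a < q | coprime a q)
    sing_c R q1 a1 q a * sing_c R q2 a2 q a * sing_c R q3 a3 q a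
    * e2pi (- n%:R * (a%:R / q%:R) : R).

Definition sing_lambda (R : realType) (n q1 q2 q3 a1 a2 a3 q : nat) : R[i]^o :=
  (totient q1 * totient q2 * totient q3)%:R
  / (totient (lcmn q1 q) * totient (lcmn q2 q) * totient (lcmn q3 q))%:R
  * sing_b R n q1 q2 q3 a1 a2 a3 q.

Definition S3_compatible (n q1 q2 q3 a1 a2 a3 : nat) : bool :=
  (n == a1 + a2 + a3 %[mod gcdn (gcdn q1 q2) q3])%N.

Definition S3 (R : realType) (n q1 q2 q3 a1 a2 a3 : nat) : R[i]^o :=
  if S3_compatible n q1 q2 q3 a1 a2 a3
  then limn (fun N => \sum_(1 <= q < N) sing_lambda R n q1 q2 q3 a1 a2 a3 q)
  else 0.

(* The order on [R[i]] is the partial one: [0 < z] says that z is a positive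
   real number. *)
Definition admissible_triplet (R : realType) (n q1 q2 q3 a1 a2 a3 : nat)
    : Prop :=
  [/\ [/\ (a1 < q1)%N, (a2 < q2)%N & (a3 < q3)%N],
      [/\ coprime a1 q1, coprime a2 q2 & coprime a3 q3],
      S3_compatible n q1 q2 q3 a1 a2 a3
    & 0 < (S3 R n q1 q2 q3 a1 a2 a3 : R[i])].

Definition admissible_a1 (R : realType) (n q3 a3 q2 a2 q1 a1 : nat) : Prop :=
  admissible_triplet R n q1 q2 q3 a1 a2 a3.

Definition admissible_a2 (R : realType) (n q3 a3 q2 a2 : nat) : Prop :=
  (a2 < q2)%N /\
  forall q1 : nat, (0 < q1)%N ->
    exists a1 : nat, admissible_a1 R n q3 a3 q2 a2 q1 a1.

(* Main.v *)
Require Import Defs.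
From mathcomp Require Import all_boot all_order all_algebra.
From mathcomp Require Import complex.
From mathcomp Require Import all_classical all_reals all_analysis.
From mathcomp Require Import zify ring lra.

(** The singular series is, up to a positive factor, the number of solutions of
    a congruence, so its sign is a question of elementary arithmetic.

    Fix Q = 2 q1 q2 q3, and let N be the number of triples x1, x2, x3 of units
    modulo Q with xi = ai mod qi and x1 + x2 + x3 = n mod Q.  Detecting the last
    congruence with the additive characters a/Q and grouping the fractions a/Q
    by their reduced denominator d gives
      sum of lambda(d) over d | Q
        = phi(q1) phi(q2) phi(q3) phi(Q)^-3 Q N
    (sum_divisors_sing_lambda): the factors phi(qi)/phi([qi,d]) in lambda(d)
    are exactly what relates c_i(a,d) to the corresponding sum modulo Q
    (weight_charsum).

    On the other hand lambda is multiplicative (sing_lambdaM) and real, it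
    vanishes at q unless every prime p divides q at most max(1, v_p(Q)) times
    (sing_lambda_support), and |lambda(p)| <= 1/(p-1)^2 for p not dividing Q
    (norm_sing_lambda_prime).  For such a function the series converges
    absolutely to the divisor sum over Q times the product of 1 + lambda(p)
    over the primes p not dividing Q.  These primes are odd as Q is even, so
    the product lies between 1/2 and 2, by comparison with the telescoping
    product of 1 - 1/k^2 over k >= 2 (euler_series).  Hence, if n is
    congruent to a1 + a2 + a3 modulo (q1,q2,q3), the singular series is
    positive if and only if N > 0 (S3_gt0E).

    If n is even then N = 0, because the xi are odd.  If n is odd, solutions are
    found by choosing residues one at a time (odd_unit_solutions): at each
    prime p one unit has to avoid the class 0 and one further class, which is
    possible for p > 2, and for p = 2 as soon as both classes are the class of
    the even numbers. *)

Set Implicit Arguments.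
Unset Strict Implicit.
Unset Printing Implicit Defensive.

Import Order.TTheory GRing.Theory Num.Theory numFieldNormedType.Exports.

(** * Units modulo M in a progression, with a prescribed sum *)

Lemma coprime_chinese_exists m1 m2 r1 r2 : coprime m1 m2 ->
  exists x, x = r1 %[mod m1] /\ x = r2 %[mod m2].
Proof.
by move=> co; exists (chinese m1 m2 r1 r2); rewrite chinese_modl ?chinese_modr.
Qed.

Lemma dvdn_congr p m x y : p %| m -> x = y %[mod m] -> (p %| x) = (p %| y).
Proof.
by move=> pm xy; rewrite /dvdn -(modn_dvdm x pm) xy modn_dvdm.
Qed.

Lemma coprime_no_common_prime m n : 0 < n ->
  (forall p, prime p -> p %| n -> ~~ (p %| m)) -> coprime m n.
Proof.
move=> n0 H; apply/negPn/negP => ncop.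
have g1 : 1 < gcdn m n.
  have: 0 < gcdn m n by rewrite gcdn_gt0 n0 orbT.
  by rewrite leq_eqVlt eq_sym -[_ == 1]/(coprime m n) (negPf ncop).
have /andP[pm pn] : (pdiv (gcdn m n) %| m) && (pdiv (gcdn m n) %| n).
  by rewrite -dvdn_gcd pdiv_dvd.
by move: (H _ (pdiv_prime g1) pn); rewrite pm.
Qed.

Lemma prime_ndvd1 p : prime p -> ~~ (p %| 1).
Proof. by move=> pp; rewrite dvdn1; apply: contraTneq pp => ->. Qed.

Lemma coprime_prime_ndvd p m n :
  prime p -> coprime m n -> p %| n -> ~~ (p %| m).
Proof.
move=> pp co pn; apply/negP => pm.
have : p %| gcdn m n by rewrite dvdn_gcd pm.
by rewrite (eqP co) dvdn1 => /eqP p1; rewrite p1 in pp.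
Qed.

(** The two factors are the largest divisor of M composed of primes dividing r,
    and the cofactor. *)
Lemma coprime_split M r : 0 < M -> 0 < r ->
  exists A B, [/\ A * B = M, coprime A B,
    (forall p, prime p -> p %| A -> p %| r) & coprime r B].
Proof.
move=> M0 r0; exists M`_\pi(r), M`_\pi(r)^'.
split; rewrite ?partnC ?coprime_partC //; last first.
  by rewrite coprime_pi' ?part_gt0 // part_pnat.
move=> p pp pM; have := pnatPpi (part_pnat \pi(r) M).
move=> /(_ p); rewrite mem_primes pp part_gt0 pM => /(_ isT).
by rewrite mem_primes => /and3P[].
Qed.

(** At a prime p dividing M but not r, the classes 0 and -s have to be avoided.
    The residue 1 does so if p divides s, and s itself does so if it does not:
    then s + s is prime to p, since p is odd as s is even.  The remainder
    theorem glues these choices to the class a modulo r. *)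
Lemma avoid_two_classes r a s M : 0 < r -> 0 < M -> 0 < s ->
  coprime a r -> ~~ odd s ->
  exists x, [/\ x = a %[mod r], coprime x M &
    forall p, prime p -> p %| M -> ~~ (p %| r) -> ~~ (p %| x + s)].
Proof.
move=> r0 M0 s0 coar evs.
have [A [T [AT coAT pA coT]]] := coprime_split M0 r0.
have T0 : 0 < T by move: M0; rewrite -AT muln_gt0 => /andP[].
have [T1 [T2 [T12 coT12 pT1 coT2]]] := coprime_split T0 s0.
have [y [y1 y2]] := coprime_chinese_exists 1 s coT12.
have [x [xr xT]] := coprime_chinese_exists a y coT.
have key p : prime p -> p %| M -> ~~ (p %| r) -> ~~ (p %| x) /\ ~~ (p %| x + s).
  move=> pp pM npr.
  have pT : p %| T.
    move: pM; rewrite -AT Euclid_dvdM // => /orP[|//] /pA.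
    by rewrite (negPf npr) => /(_ pp).
  have px : (p %| x) = (p %| y) by apply: dvdn_congr xT.
  have pxs : (p %| x + s) = (p %| y + s).
    by apply: (dvdn_congr pT); rewrite -modnDml xT modnDml.
  rewrite px pxs.
  have np1 := prime_ndvd1 pp.
  move: pT; rewrite -T12 Euclid_dvdM // => /orP[] pT.
    by rewrite dvdn_addl ?pT1 // (dvdn_congr pT y1).
  have nps : ~~ (p %| s) by apply: coprime_prime_ndvd pT.
  have -> : (p %| y + s) = (p %| s + s).
    by apply: (dvdn_congr pT); rewrite -modnDml y2 modnDml.
  rewrite (dvdn_congr pT y2) addnn -mul2n Euclid_dvdM // (negPf nps) orbF.
  split=> //; apply/negP; rewrite dvdn_prime2 // => /eqP p2.
  by move: nps; rewrite p2 dvdn2 evs.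
exists x; split=> //; last by move=> p pp pM npr; have [] := key p pp pM npr.
apply: coprime_no_common_prime => // p pp pM.
have [pr|npr] := boolP (p %| r); last by have [] := key p pp pM npr.
by rewrite (dvdn_congr pr xr); apply: coprime_prime_ndvd pr.
Qed.

Lemma predn_mul a b : 0 < a -> 0 < b -> (a * b).-1 = a.-1 * b + b.-1.
Proof. by case: a b => [//|a] [//|b] _ _; rewrite mulSn /= addnC. Qed.

(** The residues a2, x3 and x2 are obtained in this order from
    [avoid_two_classes], with s congruent to a3 - n, a2 - n and x3 - n.  Then x1,
    congruent to n - x2 - x3, is a unit at p: the choice of x2 ensures this
    when p does not divide q2, that of x3 when p divides q2 but not q3, and
    that of a2 when p divides both.  Choosing a2 only requires q2 and q3, as
    admissibility demands.  The factor 2 in the modulus makes the units odd,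
    which keeps the shifts s even. *)
Lemma odd_unit_solutions n q2 q3 a3 :
  odd n -> 0 < q2 -> 0 < q3 -> coprime a3 q3 ->
  exists a2, [/\ a2 < q2, coprime a2 q2 & forall q1, 0 < q1 ->
    let M := 2 * q1 * q2 * q3 in exists x1 x2 x3,
    [/\ coprime x1 M, coprime x2 M & coprime x3 M] /\
    [/\ x2 = a2 %[mod q2], x3 = a3 %[mod q3] & x1 + x2 + x3 = n %[mod M]]].
Proof.
move=> n_odd q20 q30 co3.
(* an odd representative of a3, so that the shift b3 - n is even *)
have [||||//|b3 [b3a3 /= b3odd _]] := @avoid_two_classes q3 a3 2 2 => //.
rewrite coprimen2 in b3odd.
pose M1 := 2 * q2 * q3; have M10 : 0 < M1 by rewrite !muln_gt0 q20 q30.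
have M1even : ~~ odd M1 by rewrite /M1 !oddM.
have n0 : 0 < n by case: n n_odd.
(* (M1 - 1) n stands for - n modulo M1, which avoids subtraction *)
have [|||||x2 [_ co2 av2]] := @avoid_two_classes 1 0 (b3 + M1.-1 * n) M1 => //.
- by rewrite addn_gt0 (_ : 0 < b3) //; case: b3 b3odd {b3a3}.
- by rewrite oddD oddM b3odd n_odd andbT -subn1 oddB // (negPf M1even).
have x2odd : odd x2.
  by rewrite -coprimen2; apply: coprime_dvdr co2; rewrite /M1 -mulnA dvdn_mulr.
have coq2 : coprime x2 q2.
  by apply: coprime_dvdr co2; rewrite /M1 mulnAC dvdn_mull.
exists (x2 %% q2); rewrite coprime_modl ltn_mod; split=> // q1 q10 /=.
set M := 2 * q1 * q2 * q3.
have M0 : 0 < M by rewrite !muln_gt0 q10 q20 q30.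
have ME : M = q1 * M1 by rewrite /M /M1; ring.
have Meven : ~~ odd M by rewrite ME oddM (negPf M1even) andbF.
have [|||||x3 [x3a3 cox3 av3]] := @avoid_two_classes q3 a3 (x2 + M.-1 * n) M => //.
- by rewrite addn_gt0 (_ : 0 < x2) //; case: x2 x2odd {av2 co2 coq2}.
- by rewrite oddD oddM x2odd n_odd andbT -subn1 oddB // (negPf Meven).
have x3odd : odd x3.
  by rewrite -coprimen2; apply: coprime_dvdr cox3; rewrite /M -!mulnA dvdn_mulr.
have [|||||y2 [y2x2 coy2 avy]] := @avoid_two_classes q2 x2 (x3 + M.-1 * n) M => //.
- by rewrite addn_gt0 (_ : 0 < x3) //; case: x3 x3odd {av3 x3a3 cox3}.
- by rewrite oddD oddM x3odd n_odd andbT -subn1 oddB // (negPf Meven).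
(* x1 is congruent to n - x2 - x3 mod M *)
exists (n + M.-1 * (y2 + x3)), y2, x3; split; last first.
  split=> //; first by rewrite y2x2 modn_mod.
  have -> : n + M.-1 * (y2 + x3) + y2 + x3 = (y2 + x3) * M + n.
    by move: M0; case: (M) => //= m _; ring.
  by rewrite modnMDl.
split=> //; apply: coprime_no_common_prime => // p pp pM; apply/negP => px1.
have pyx : p %| y2 + (x3 + M.-1 * n).
  rewrite -(dvdn_addr _ px1).
  have -> : n + M.-1 * (y2 + x3) + (y2 + (x3 + M.-1 * n)) = M * (n + y2 + x3).
    by move: M0; case: (M) => //= m _; ring.
  by rewrite dvdn_mulr.
have [pq2|npq2] := boolP (p %| q2); last by move: (avy p pp pM npq2); rewrite pyx.
have y2x2p : y2 = x2 %[mod p] by rewrite -(modn_dvdm y2 pq2) y2x2 modn_dvdm.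
have [pq3|npq3] := boolP (p %| q3); last first.
  move: (av3 p pp pM npq3); rewrite (_ : p %| _) //.
  rewrite -(dvdn_congr (dvdnn p) (x := y2 + (x3 + M.-1 * n))) //.
  by rewrite -modnDml y2x2p modnDml addnCA.
have x3b3p : x3 = b3 %[mod p].
  by rewrite -(modn_dvdm x3 pq3) x3a3 -b3a3 modn_dvdm.
have pM1 : p %| M1 by rewrite /M1 dvdn_mull.
move: (av2 p pp pM1 (prime_ndvd1 pp)).
rewrite (_ : p %| _) //.
rewrite -(dvdn_congr (dvdnn p) (x := y2 + (x3 + M.-1 * n))) //.
have -> : M.-1 = q1.-1 * M1 + M1.-1 by rewrite ME predn_mul.
rewrite -modnDml y2x2p modnDml -modnDmr -(modnDml x3) x3b3p modnDml modnDmr.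
rewrite mulnDl.
have -> : x2 + (b3 + (q1.-1 * M1 * n + M1.-1 * n)) =
    q1.-1 * n * M1 + (x2 + (b3 + M1.-1 * n)) by ring.
by rewrite -modnDml (eqP (dvdn_mull _ pM1)).
Qed.

Local Open Scope ring_scope.

(** * Sums over residue classes *)

Definition mod_periodic (V : Type) (q : nat) (F : nat -> V) :=
  forall a, F (a %% q)%N = F a.

(** All the reindexings of sums over residues below, by translations, by
    multiplication by units and by the remainder theorem, are instances. *)
Lemma sum_residues (V : nmodType) (I : finType) (q : nat) (g : I -> nat)
    (F : nat -> V) : (0 < q)%N -> #|I| = q ->
    (forall i j, g i = g j %[mod q] -> i = j) -> mod_periodic q F ->
  \sum_(0 <= a < q) F a = \sum_i F (g i).
Proof.
move=> q0 cI ginj Fper; rewrite big_mkord.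
pose h (i : I) : 'I_q := Ordinal (ltn_pmod (g i) q0).
have hinj : injective h by move=> i j /(congr1 val) /= /ginj.
have hbij : bijective h by apply: inj_card_bij => //; rewrite card_ord cI.
rewrite (reindex h) /=; last exact: onW_bij.
by apply: eq_bigr => i _; rewrite Fper.
Qed.

Lemma sum_residues_reindex (V : nmodType) (q : nat) (g : nat -> nat) (F : nat -> V) :
    (0 < q)%N -> (forall i j, g i = g j %[mod q] -> i = j %[mod q]) ->
    mod_periodic q F ->
  \sum_(0 <= a < q) F a = \sum_(0 <= a < q) F (g a).
Proof.
move=> q0 ginj Fper; rewrite [RHS]big_mkord.
apply: (sum_residues (g := fun i : 'I_q => g i)) => //; first by rewrite card_ord.
by move=> i j /ginj; rewrite !modn_small // => /val_inj.
Qed.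

Lemma sum_residues_pair (V : nmodType) (q r : nat) (g : nat -> nat -> nat)
    (F : nat -> V) : (0 < q)%N -> (0 < r)%N ->
    (forall i j i' j', (i < q)%N -> (j < r)%N -> (i' < q)%N -> (j' < r)%N ->
      g i j = g i' j' %[mod q * r] -> i = i' /\ j = j') ->
    mod_periodic (q * r) F ->
  \sum_(0 <= a < q * r) F a = \sum_(0 <= i < q) \sum_(0 <= j < r) F (g i j).
Proof.
move=> q0 r0 ginj Fper; rewrite [RHS]big_mkord.
rewrite (eq_bigr (fun i : 'I_q => \sum_(j < r) F (g i j))); last first.
  by move=> i _; rewrite big_mkord.
rewrite pair_big /=.
apply: (sum_residues (g := fun p : 'I_q * 'I_r => g p.1 p.2)) => //.
- by rewrite muln_gt0 q0.
- by rewrite card_prod !card_ord.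
- move=> [i j] [i' j'] /= /ginj -/(_ (ltn_ord _) (ltn_ord _) (ltn_ord _) (ltn_ord _)).
  by move=> [/val_inj -> /val_inj ->].
Qed.

Lemma eqn_mod_mul2l d x y z : coprime x d ->
  (x * y == x * z %[mod d])%N = (y == z %[mod d])%N.
Proof.
move=> co; wlog le_yz : y z / (y <= z)%N => [H|].
  by case/orP: (leq_total y z) => /H // e; rewrite eq_sym e eq_sym.
rewrite eq_sym [RHS]eq_sym !eqn_mod_dvd ?leq_mul2l ?le_yz ?orbT //.
by rewrite -mulnBr Gauss_dvdr // coprime_sym.
Qed.

(** This is the decomposition of a/(qr) as i/q + j/r modulo 1. *)
Lemma crt_combination_inj q r i j i' j' : (0 < q)%N -> (0 < r)%N -> coprime q r ->
  (i < q)%N -> (j < r)%N -> (i' < q)%N -> (j' < r)%N ->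
  (i * r + j * q = i' * r + j' * q %[mod q * r])%N -> i = i' /\ j = j'.
Proof.
move=> q0 r0 co iq jr iq' jr' /eqP; rewrite chinese_remainder // => /andP[].
rewrite -!(addnC (_ * q)%N) !modnMDl addnC [(_ + i' * r)%N]addnC !modnMDl.
rewrite !(mulnC _ r) !(mulnC _ q) eqn_mod_mul2l 1?coprime_sym //.
rewrite eqn_mod_mul2l //.
by rewrite !modn_small // => /eqP -> /eqP ->.
Qed.

Lemma sum_residues_prod (C : comPzRingType) (q r : nat) (f g : nat -> C) :
  (0 < q)%N -> (0 < r)%N -> coprime q r -> mod_periodic q f -> mod_periodic r g ->
  \sum_(0 <= k < q * r) f k * g k =
  (\sum_(0 <= k < q) f k) * (\sum_(0 <= k < r) g k).
Proof.
move=> q0 r0 co fper gper.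
rewrite (sum_residues_pair (g := fun i j => chinese q r i j)) //; last 2 first.
- move=> i j i' j' iq jr iq' jr' /eqP; rewrite chinese_remainder // => /andP[].
  by rewrite !chinese_modl // !chinese_modr // !modn_small // => /eqP -> /eqP ->.
- move=> a; congr (_ * _).
    by rewrite -fper modn_dvdm ?dvdn_mulr // fper.
  by rewrite -gper modn_dvdm ?dvdn_mull // gper.
rewrite big_distrl /=; apply: eq_bigr => i _.
rewrite big_distrr /=; apply: eq_bigr => j _.
by rewrite -fper chinese_modl // fper -[g (_)]gper chinese_modr // gper.
Qed.

(** * Totients, unit classes and divisors *)

Lemma prod_primes (F : nat -> nat) n B : (0 < n)%N -> (n < B)%N ->
  (\prod_(p <- primes n) F p = \prod_(0 <= p < B | prime p && (p %| n)) F p)%N.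
Proof.
move=> n0 nB; rewrite -[RHS]big_filter; apply: perm_big.
apply: uniq_perm; rewrite ?primes_uniq ?filter_uniq ?iota_uniq //.
move=> p; rewrite mem_filter mem_index_iota mem_primes n0 /=.
apply/andP/andP => [[pp pn]|[/andP[]//]]; split; first by rewrite pp.
by rewrite (leq_ltn_trans (dvdn_leq n0 pn) nB).
Qed.

(** At each prime, the valuations of the lcm and of the gcd are those of m and n,
    up to exchange. *)
Lemma totient_lcm_gcd m n : (0 < m)%N -> (0 < n)%N ->
  (totient (lcmn m n) * totient (gcdn m n) = totient m * totient n)%N.
Proof.
move=> m0 n0.
have l0 : (0 < lcmn m n)%N by rewrite lcmn_gt0 m0.
have g0 : (0 < gcdn m n)%N by rewrite gcdn_gt0 m0.
pose h p k := if k is k'.+1 then (p.-1 * p ^ k')%N else 1%N.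
pose B := (lcmn m n + m + n + gcdn m n).+1.
have E a : (0 < a)%N -> (a < B)%N ->
    totient a = (\prod_(0 <= p < B | prime p) h p (logn p a))%N.
  move=> a0 aB; rewrite totientE // (@prod_primes _ a B) //.
  rewrite big_mkcondr /=; apply: eq_bigr => p pp.
  rewrite -{1}[p]expn1 pfactor_dvdn //.
  by rewrite /h; case: (logn p a).
rewrite !E //; try by rewrite /B; lia.
rewrite -!big_split /=; apply: eq_bigr => p _.
rewrite logn_gcd // logn_lcm //; case: (leqP (logn p m) (logn p n)) => _ //.
by rewrite mulnC.
Qed.

(** The remainder theorem for moduli that need not be coprime, by Bezout. *)
Lemma gcd_chinese_exists d q k a : (0 < d)%N -> (0 < q)%N ->
  (k = a %[mod gcdn d q])%N ->
  exists y, (y = k %[mod d])%N /\ (y = a %[mod q])%N.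
Proof.
move=> d0 q0 ka; case: (egcdnP q d0) => u v uv _.
(* a representative of a that is at least k, so that a' - k is not truncated *)
pose a' := (k * q + a)%N.
have ka' : (k <= a')%N by rewrite /a'; nia.
have /dvdnP[s sE] : (gcdn d q %| a' - k)%N.
  rewrite -eqn_mod_dvd // /a'; have /dvdnP[t tE] := dvdn_gcdr d q.
  by rewrite [in (k * q)%N]tE mulnA modnMDl -ka.
exists (k + s * u * d)%N; rewrite addnC modnMDl; split=> //.
have -> : (s * u * d + k = (s * v + k) * q + a)%N.
  by rewrite -mulnA uv mulnDr -sE -/a'; nia.
by rewrite modnMDl.
Qed.

(** Reduction from units modulo Q to units modulo L is onto with fibres of equal
    size: multiplication by a lift of y sends the fibre of 1 to that of y. *)
Lemma unit_fiber L Q y : (0 < Q)%N -> (L %| Q)%N -> coprime y L ->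
  (totient L * \sum_(0 <= x < Q) (coprime x Q && (x == y %[mod L])))%N
  = totient Q.
Proof.
move=> Q0 LQ; have L0 : (0 < L)%N by apply: dvdn_gt0 LQ.
pose S (y : nat) := (\sum_(0 <= x < Q) (coprime x Q && (x == y %[mod L])))%N.
have S1 z : coprime z L -> S z = S 1%N.
  move=> coz; have [||||//|w [wz cow _]] := @avoid_two_classes L z 2 Q => //.
  rewrite /S (sum_residues_reindex (g := muln w) (q := Q)) //; last 2 first.
  - by move=> i j /eqP; rewrite eqn_mod_mul2l // => /eqP.
  - by move=> x; rewrite coprime_modl modn_dvdm.
  apply: eq_bigr => x _; rewrite coprimeMl cow /=; congr (nat_of_bool (_ && _)).
  rewrite -wz -[in RHS](@eqn_mod_mul2l L w) ?muln1 //.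
  by apply: coprime_dvdr cow.
move=> coy; rewrite -/(S y) S1 //.
rewrite [RHS]totient_count_coprime.
transitivity (\sum_(0 <= z < L) S z)%N; last first.
  rewrite /S exchange_big /=; apply: eq_big_nat => x xQ.
  rewrite (bigD1_seq (x %% L)%N) ?mem_index_iota ?iota_uniq ?ltn_mod //=.
  rewrite modn_mod eqxx andbT big1_seq ?addn0 1?coprime_sym // => z.
  rewrite mem_index_iota => /andP[zn /= zL].
  by rewrite (modn_small zL) eq_sym (negPf zn) andbF.
rewrite totient_count_coprime big_distrl /=; apply: eq_big_nat => z zL.
rewrite coprime_sym; case: (boolP (coprime z L)) => [/S1->|nco]; first by rewrite mul1n.
rewrite mul0n /S big1 // => x _; case: eqP => [xz|]; last by rewrite andbF.
rewrite andbT; case: (boolP (coprime x Q)) => // cox; case/negP: nco.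
by rewrite -coprime_modl -xz coprime_modl; apply: coprime_dvdr cox.
Qed.

(** Every fraction a/Q is a'/d with d dividing Q and a' prime to d, namely
    d = Q / gcd(a, Q). *)
Lemma sum_by_denominator (V : nmodType) Q (F : nat -> V) : (0 < Q)%N ->
  \sum_(0 <= a < Q) F a =
  \sum_(d <- divisors Q) \sum_(0 <= a < d | coprime a d) F (Q %/ d * a)%N.
Proof.
move=> Q0.
transitivity (\sum_(0 <= a < Q) \sum_(d <- divisors Q | d == (Q %/ gcdn a Q)%N) F a).
  apply: eq_bigr => a _; rewrite -big_filter (perm_big [:: (Q %/ gcdn a Q)%N]) /=.
    by rewrite big_seq1.
  apply: uniq_perm; rewrite ?filter_uniq ?divisors_uniq // => d.
  rewrite mem_filter inE -dvdn_divisors //; case: eqP => // ->.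
  by rewrite -[X in (_ %| X)%N](@divnK (gcdn a Q) Q) ?dvdn_gcdr // dvdn_mulr.
rewrite (exchange_big_dep xpredT) //=; apply: eq_big_seq => d.
rewrite -dvdn_divisors // => /dvdnP[h QE].
have /andP[h0 d0] : (0 < h)%N && (0 < d)%N by rewrite -muln_gt0 -QE.
rewrite QE mulnK // -[LHS]big_filter -[RHS]big_filter.
rewrite -(big_map (muln h) xpredT F); apply: perm_big.
apply: uniq_perm; rewrite ?filter_uniq ?iota_uniq //.
  rewrite map_inj_uniq ?filter_uniq ?iota_uniq // => x y /eqP.
  by rewrite eqn_pmul2l // => /eqP.
move=> a; rewrite mem_filter mem_index_iota.
apply/andP/mapP => [[/eqP dE /= aQ]|[b]].
  have gE : gcdn a (h * d) = h.
    apply/eqP; rewrite -(@eqn_pmul2l d) //.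
    by have := divnK (dvdn_gcdr a (h * d)); rewrite -dE mulnC => ->; rewrite mulnC.
  have ha : (h %| a)%N by rewrite -gE dvdn_gcdl.
  exists (a %/ h)%N; last by rewrite mulnC divnK.
  rewrite mem_filter mem_index_iota /= ltn_divLR // (mulnC d) aQ andbT.
  by rewrite /coprime -(@eqn_pmul2l h) // muln_gcdr (mulnC h (_ %/ _)%N) divnK // gE muln1.
rewrite mem_filter mem_index_iota /= => /andP[cob bd] ->; split; last by rewrite ltn_pmul2l.
by rewrite -muln_gcdr (eqP cob) muln1 mulKn.
Qed.

Lemma sum_divisors_coprime (C : pzRingType) M p (f : nat -> C) :
  (0 < M)%N -> prime p -> ~~ (p %| M)%N ->
  (forall d, (d %| M)%N -> f (d * p)%N = f d * f p) ->
  \sum_(d <- divisors (M * p)) f d = (\sum_(d <- divisors M) f d) * (1 + f p).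
Proof.
move=> M0 pp npM fmul.
have p0 := prime_gt0 pp.
rewrite (perm_big (divisors M ++ map (muln^~ p) (divisors M))).
  rewrite big_cat big_map mulrDr mulr1 /=; congr (_ + _).
  rewrite big_distrl /=; apply: eq_big_seq => d.
  by rewrite -dvdn_divisors // => /fmul.
apply: uniq_perm; rewrite ?divisors_uniq //.
  rewrite cat_uniq !divisors_uniq /= map_inj_uniq ?divisors_uniq ?andbT.
    apply/hasPn => _ /mapP[d _ ->] /=; rewrite -dvdn_divisors //.
    by apply: contra npM => /(dvdn_trans _) -> //; rewrite dvdn_mull.
  by move=> x y /eqP; rewrite eqn_pmul2r // => /eqP.
move=> d; rewrite mem_cat -!dvdn_divisors ?muln_gt0 ?M0 //.
apply/idP/orP => [dM|[dM|/mapP[e]]]; last 2 first.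
- by rewrite dvdn_mulr.
- by rewrite -dvdn_divisors // => eM ->; rewrite dvdn_pmul2r.
have [pd|npd] := boolP (p %| d)%N; last first.
  by left; rewrite -(@Gauss_dvdl _ _ p) // coprime_sym prime_coprime.
right; apply/mapP; exists (d %/ p)%N; rewrite ?divnK //.
by rewrite -dvdn_divisors // -(@dvdn_pmul2r p) // divnK.
Qed.

Local Open Scope complex_scope.

(** * The root of unity e(1/q) *)

Definition zeta (R : realType) (q : nat) : R[i] := e2pi (q%:R^-1 : R).

Lemma e2piD (R : realType) (x y : R) :
  e2pi (x + y) = e2pi x * e2pi y :> R[i].
Proof.
rewrite /e2pi mulrDr cosD sinD; apply/eqP; rewrite eq_complex /=.
by apply/andP; split; apply/eqP; ring.
Qed.

Lemma e2pi0 (R : realType) : e2pi (0 : R) = 1 :> R[i].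
Proof. by rewrite /e2pi mulr0 cos0 sin0. Qed.

Lemma e2pi1 (R : realType) : e2pi (1 : R) = 1 :> R[i].
Proof. by rewrite /e2pi mulr1 mulr_natl cos2pi sin2pi. Qed.

Lemma e2piX (R : realType) (x : R) k : e2pi (x *+ k) = (e2pi x : R[i]) ^+ k :> R[i].
Proof.
by elim: k => [|k IH]; rewrite ?mulr0n ?e2pi0 // mulrS e2piD IH exprS.
Qed.

Lemma e2piN (R : realType) (x : R) : e2pi (- x) = (e2pi x : R[i])^-1 :> R[i].
Proof.
have H : (e2pi (- x) : R[i]) * e2pi x = 1 by rewrite -e2piD addNr e2pi0.
have x0 : (e2pi x : R[i]) != 0.
  by apply: contra_eq_neq H => ->; rewrite mulr0 eq_sym oner_eq0.
by apply: (mulIf x0); rewrite H mulVf.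
Qed.

Lemma e2pi_conj (R : realType) (x : R) : (e2pi x : R[i])^* = (e2pi x : R[i])^-1.
Proof. by rewrite -e2piN /e2pi mulrN cosN sinN. Qed.

(** The cosine is injective on [0, pi], which settles x <= 1/2; the other half
    follows by the symmetry x -> 1 - x. *)
Lemma cos2pi_neq1 (R : realType) (x : R) : 0 < x < 1 -> cos (2 * pi * x) != 1.
Proof.
have p0 := pi_gt0 R.
have half (y : R) : 0 < y <= 2^-1 -> cos (2 * pi * y) != 1.
  move=> /andP[y0 y1]; apply/negP => /eqP; rewrite -[X in _ = X]cos0 => H.
  have : 2 * pi * y = 0.
    apply: cos_inj H; last by rewrite in_itv /= lexx ltW.
    rewrite in_itv /=; apply/andP; split; first by rewrite !mulr_ge0 // ltW.
    by rewrite mulrAC -[leRHS]mul1r ler_pM2r //; lra.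
  by move/eqP; rewrite !mulf_eq0 pnatr_eq0 /= !gt_eqF.
move=> /andP[x0 x1]; have [xh|xh] := leP x 2^-1; first by apply: half; rewrite x0.
have -> : cos (2 * pi * x) = cos (2 * pi * (1 - x)).
  by rewrite mulrBr mulr1 -[RHS]cosN opprB -[RHS]cosD2pi mulr_natl subrK.
by apply: half; lra.
Qed.

Lemma e2pi_eq1 (R : realType) (x : R) : 0 <= x < 1 -> e2pi x = 1 :> R[i] -> x = 0.
Proof.
move=> /andP[x0 x1] [c1 _]; apply/eqP; apply: contraT => nx0.
have x01 : 0 < x < 1 by rewrite x1 lt_neqAle eq_sym nx0 x0.
by have := cos2pi_neq1 x01; rewrite c1 eqxx.
Qed.

Lemma zetaXn (R : realType) q h : (0 < q)%N -> (0 < h)%N ->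
  zeta R (h * q) ^+ h = zeta R q.
Proof.
move=> q0 h0; rewrite /zeta -e2piX; congr e2pi.
rewrite -[LHS]mulr_natr natrM invfM mulrAC mulVf ?mul1r //.
by rewrite pnatr_eq0 -lt0n.
Qed.

Lemma zetaX_div (R : realType) d Q : (0 < Q)%N -> (d %| Q)%N ->
  zeta R Q ^+ (Q %/ d) = zeta R d.
Proof.
move=> Q0 /dvdnP[h QE]; move: Q0; rewrite QE muln_gt0 => /andP[h0 d0].
by rewrite mulnK // zetaXn.
Qed.

Lemma zeta1 (R : realType) : zeta R 1 = 1.
Proof. by rewrite /zeta invr1 e2pi1. Qed.

Lemma zetaX_order (R : realType) q : (0 < q)%N -> zeta R q ^+ q = 1.
Proof. by move=> q0; rewrite -[in X in X ^+ _](muln1 q) zetaXn // zeta1. Qed.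

Lemma zetaX_mod (R : realType) q k : (0 < q)%N ->
  zeta R q ^+ (k %% q)%N = zeta R q ^+ k.
Proof.
move=> q0; rewrite [in RHS](divn_eq k q) exprD mulnC exprM zetaX_order //.
by rewrite expr1n mul1r.
Qed.

Lemma zetaX_eq (R : realType) q k l : (0 < q)%N -> (k = l %[mod q])%N ->
  zeta R q ^+ k = zeta R q ^+ l.
Proof. by move=> q0 kl; rewrite -zetaX_mod // kl zetaX_mod. Qed.

Lemma zetaX_eq1 (R : realType) q k : (0 < q)%N ->
  zeta R q ^+ k = 1 -> (q %| k)%N.
Proof.
move=> q0; rewrite -zetaX_mod // /zeta -e2piX => /e2pi_eq1 H.
have : q%:R^-1 *+ (k %% q) = 0 :> R.
  apply: H; rewrite mulrn_wge0 ?invr_ge0 ?ler0n //=.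
  rewrite -[X in X < _]mulr_natr mulrC ltr_pdivrMr ?ltr0n // mul1r ltr_nat.
  by rewrite ltn_mod.
move/eqP; rewrite mulrn_eq0 invr_eq0 pnatr_eq0 => /orP[//|].
by rewrite eqn0Ngt q0.
Qed.

Lemma zeta_neq0 (R : realType) q : (0 < q)%N -> zeta R q != 0.
Proof.
move=> q0; apply/eqP => z0; have /eqP := zetaX_order R q0.
by rewrite z0 expr0n gtn_eqF //= eq_sym oner_eq0.
Qed.

Lemma conj_zetaX (R : realType) q k : (0 < q)%N ->
  (zeta R q ^+ k)^* = zeta R q ^+ (q.-1 * k).
Proof.
move=> q0; rewrite rmorphXn exprM; congr (_ ^+ _); rewrite [LHS]e2pi_conj.
apply: (mulIf (zeta_neq0 R q0)); rewrite mulVf ?zeta_neq0 //.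
by rewrite -exprSr prednK // zetaX_order.
Qed.

Lemma norm_zeta (R : realType) q : `|zeta R q| = 1.
Proof.
rewrite normc_def /zeta /e2pi /= cos2Dsin2; congr (_%:C); exact: sqrtr1.
Qed.

Lemma e2pi_frac (R : realType) (a q k : nat) :
  e2pi (a%:R / q%:R * k%:R : R) = zeta R q ^+ (a * k) :> R[i].
Proof.
rewrite /zeta -e2piX; congr e2pi.
by rewrite -[RHS]mulr_natr natrM; ring.
Qed.

(** * The terms of the singular series *)

(** The summation condition of c_j(a,q), with s = q_j. *)
Definition unit_in_class (q s a k : nat) : bool :=
  coprime k q && (k == a %[mod gcdn q s])%N.

(** c_j(b,q) for q_j = s and a_j = a, over the residues 0, ..., q - 1 and with
    powers of one root of unity in place of exponentials. *)
Definition charsum (R : realType) (q s a b : nat) : R[i] :=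
  \sum_(0 <= k < q) (unit_in_class q s a k)%:R * zeta R q ^+ (b * k).

(** The same rewriting of b(q). *)
Definition trisum (R : realType) (n q1 q2 q3 a1 a2 a3 q : nat) : R[i] :=
  \sum_(0 <= a < q) (coprime a q)%:R *
    (charsum R q q1 a1 a * charsum R q q2 a2 a * charsum R q q3 a3 a *
     (zeta R q ^+ (a * n))^-1).

(** The factor of lambda(q) belonging to one of the three progressions. *)
Definition weight (R : realType) (s q : nat) : R[i] :=
  (totient s)%:R / (totient (lcmn s q))%:R.

Lemma unit_in_class_mod q s a k : unit_in_class q s a (k %% q)%N = unit_in_class q s a k.
Proof. by rewrite /unit_in_class coprime_modl modn_dvdm ?dvdn_gcdl. Qed.

Lemma charsum_periodic (R : realType) q s a : (0 < q)%N ->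
  mod_periodic q (charsum R q s a).
Proof.
move=> q0 b; apply: eq_bigr => k _; congr (_ * _).
by apply: zetaX_eq; rewrite ?modnMml.
Qed.

Lemma sing_cE (R : realType) s a q b : (0 < q)%N ->
  sing_c R s a q b = charsum R q s a b.
Proof.
move=> q0; rewrite /sing_c /charsum big_mkcond big_add1 /=.
pose F k := (unit_in_class q s a k)%:R * zeta R q ^+ (b * k).
rewrite [RHS](sum_residues_reindex (F := F) (g := S)) //; last 2 first.
- by move=> i j /eqP; rewrite -addn1 -(addn1 j) eqn_modDr => /eqP.
- by move=> k; rewrite /F unit_in_class_mod; congr (_ * _); apply: zetaX_eq; rewrite ?modnMmr.
apply: eq_bigr => k _; rewrite /F /unit_in_class; case: ifP => _; last by rewrite mul0r.
by rewrite mul1r e2pi_frac.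
Qed.

Lemma sing_bE (R : realType) n q1 q2 q3 a1 a2 a3 q : (0 < q)%N ->
  sing_b R n q1 q2 q3 a1 a2 a3 q = trisum R n q1 q2 q3 a1 a2 a3 q.
Proof.
move=> q0; rewrite /sing_b /trisum big_mkcond; apply: eq_bigr => a _.
case: (boolP (coprime a q)) => _; last by rewrite mul0r.
rewrite mul1r !sing_cE //; congr (_ * _).
by rewrite mulNr e2piN mulrC e2pi_frac.
Qed.

Lemma totient_neq0 (R : realType) q : (0 < q)%N -> (totient q)%:R != 0 :> R[i].
Proof. by move=> q0; rewrite pnatr_eq0 -lt0n totient_gt0. Qed.

(** In this form the weight depends on q only through quantities that are
    multiplicative in q. *)
Lemma weightE (R : realType) s q : (0 < s)%N -> (0 < q)%N ->
  weight R s q = (totient (gcdn s q))%:R / (totient q)%:R.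
Proof.
move=> s0 q0; have := totient_lcm_gcd s0 q0.
move=> /(congr1 (fun m => m%:R : R[i])); rewrite !natrM => E.
rewrite /weight; apply/eqP; rewrite eqr_div ?totient_neq0 ?lcmn_gt0 ?s0 //.
by rewrite -E mulrC.
Qed.

Lemma sing_lambdaE (R : realType) n q1 q2 q3 a1 a2 a3 q : (0 < q)%N ->
  sing_lambda R n q1 q2 q3 a1 a2 a3 q =
  weight R q1 q * weight R q2 q * weight R q3 q * trisum R n q1 q2 q3 a1 a2 a3 q.
Proof.
move=> q0; rewrite /sing_lambda sing_bE //; congr (_ * _).
rewrite /weight !natrM !invfM.
by ring.
Qed.

Lemma gcdnM_coprime q r s : coprime q r ->
  gcdn (q * r) s = (gcdn q s * gcdn r s)%N.
Proof.
move=> co; apply/eqP; rewrite eqn_dvd; apply/andP; split.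
  rewrite muln_gcdl !muln_gcdr !dvdn_gcd dvdn_gcdl /=.
  have gs := dvdn_gcdr (q * r) s.
  by rewrite (dvdn_mull q gs) (dvdn_mulr r gs) (dvdn_mulr s gs).
rewrite dvdn_gcd dvdn_mul ?dvdn_gcdl //= Gauss_dvd ?dvdn_gcdr //.
by apply: coprime_dvdl (dvdn_gcdl _ _) _; apply: coprime_dvdr (dvdn_gcdl _ _) _.
Qed.

Lemma unit_in_classM q r s a k : coprime q r ->
  unit_in_class (q * r) s a k = unit_in_class q s a k && unit_in_class r s a k.
Proof.
move=> co; rewrite /unit_in_class gcdnM_coprime // coprimeMr chinese_remainder; last first.
  by apply: coprime_dvdl (dvdn_gcdl _ _) _; apply: coprime_dvdr (dvdn_gcdl _ _) _.
by rewrite andbACA.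
Qed.

Lemma zeta_crt (R : realType) q r i j k : (0 < q)%N -> (0 < r)%N ->
  zeta R (q * r) ^+ ((i * r + j * q) * k) =
  zeta R q ^+ (i * k) * zeta R r ^+ (j * k).
Proof.
move=> q0 r0; rewrite mulnDl exprD; congr (_ * _).
  by rewrite mulnAC [(i * k * r)%N]mulnC exprM [(q * r)%N]mulnC zetaXn.
by rewrite mulnAC [(j * k * q)%N]mulnC exprM zetaXn.
Qed.

Lemma charsumM (R : realType) q r s a i j :
  (0 < q)%N -> (0 < r)%N -> coprime q r ->
  charsum R (q * r) s a (i * r + j * q) = charsum R q s a i * charsum R r s a j.
Proof.
move=> q0 r0 co; rewrite /charsum -sum_residues_prod //; last 2 first.
- by move=> k; rewrite unit_in_class_mod; congr (_ * _); apply: zetaX_eq; rewrite ?modnMmr.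
- by move=> k; rewrite unit_in_class_mod; congr (_ * _); apply: zetaX_eq; rewrite ?modnMmr.
by apply: eq_bigr => k _; rewrite zeta_crt // unit_in_classM // -mulnb natrM mulrACA.
Qed.

Lemma trisumM (R : realType) n q1 q2 q3 a1 a2 a3 q r :
  (0 < q)%N -> (0 < r)%N -> coprime q r ->
  trisum R n q1 q2 q3 a1 a2 a3 (q * r) =
  trisum R n q1 q2 q3 a1 a2 a3 q * trisum R n q1 q2 q3 a1 a2 a3 r.
Proof.
move=> q0 r0 co; rewrite {1}/trisum.
rewrite (sum_residues_pair (g := fun i j => (i * r + j * q)%N)) //; last 2 first.
- by move=> i j i' j' *; apply: (@crt_combination_inj q r).
- move=> k; rewrite coprime_modl !charsum_periodic ?muln_gt0 ?q0 //.
  by do 2!congr (_ * _); congr (_^-1); apply: zetaX_eq; rewrite ?muln_gt0 ?q0 ?modnMml.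
rewrite /trisum big_distrl /=; apply: eq_bigr => i _.
rewrite big_distrr /=; apply: eq_bigr => j _.
rewrite !charsumM // zeta_crt // invfM coprimeMr.
have -> : coprime (i * r + j * q) q = coprime i q.
  rewrite -coprime_modl addnC modnMDl coprime_modl coprimeMl.
  by rewrite [coprime r q]coprime_sym co andbT.
have -> : coprime (i * r + j * q) r = coprime j r.
  by rewrite -coprime_modl modnMDl coprime_modl coprimeMl co andbT.
by rewrite -mulnb natrM; ring.
Qed.

Lemma weightM (R : realType) s q r :
  (0 < s)%N -> (0 < q)%N -> (0 < r)%N -> coprime q r ->
  weight R s (q * r) = weight R s q * weight R s r.
Proof.
move=> s0 q0 r0 co; rewrite !weightE ?muln_gt0 ?q0 // totient_coprime //.
rewrite gcdnC gcdnM_coprime // totient_coprime; last first.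
  by apply: coprime_dvdl (dvdn_gcdl _ _) _; apply: coprime_dvdr (dvdn_gcdl _ _) _.
by rewrite !natrM invfM ![gcdn _ s]gcdnC mulrACA.
Qed.

Lemma sing_lambdaM (R : realType) n q1 q2 q3 a1 a2 a3 q r :
  (0 < q1)%N -> (0 < q2)%N -> (0 < q3)%N ->
  (0 < q)%N -> (0 < r)%N -> coprime q r ->
  sing_lambda R n q1 q2 q3 a1 a2 a3 (q * r) =
  sing_lambda R n q1 q2 q3 a1 a2 a3 q * sing_lambda R n q1 q2 q3 a1 a2 a3 r.
Proof.
move=> q10 q20 q30 q0 r0 co.
rewrite !sing_lambdaE ?muln_gt0 ?q0 // !weightM // trisumM //.
rewrite [RHS]mulrACA; congr (_ * _).
by rewrite [RHS]mulrACA; congr (_ * _); rewrite mulrACA.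
Qed.

(** The translation by q/p preserves the conditions on the summation variable:
    coprimality to q because p divides q/p, and the congruence because (q,s)
    divides q/p.  It multiplies every term by the same p-th root of unity,
    which is not 1. *)
Lemma charsum_eq0 (R : realType) q s a b p : (0 < q)%N -> prime p ->
  (p * p %| q)%N -> (gcdn q s %| q %/ p)%N -> coprime b q ->
  charsum R q s a b = 0.
Proof.
move=> q0 pp ppq gq cob; have p0 := prime_gt0 pp.
have pq : (p %| q)%N by apply: dvdn_trans ppq; rewrite dvdn_mulr.
pose h := (q %/ p)%N; have qE : (h * p)%N = q by rewrite divnK.
have h0 : (0 < h)%N by move: q0; rewrite -qE muln_gt0 => /andP[].
have ph : (p %| h)%N by rewrite -(@dvdn_pmul2r p) // qE.
have E : charsum R q s a b = charsum R q s a b * zeta R p ^+ b.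
  rewrite {1}/charsum (sum_residues_reindex (g := addn h)) //; last 2 first.
  - by move=> i j /eqP; rewrite eqn_modDl => /eqP.
  - by move=> k; rewrite unit_in_class_mod; congr (_ * _); apply: zetaX_eq; rewrite ?modnMmr.
  rewrite /charsum big_distrl /=; apply: eq_bigr => k _.
  rewrite -mulrA; congr (_ * _).
    congr (_%:R); congr nat_of_bool; rewrite /unit_in_class; congr (_ && _); last first.
      have /dvdnP[t tE] := gq; rewrite -/h in tE.
      by rewrite [in (h + k)%N]tE modnMDl.
    rewrite -qE !coprimeMr.
    have -> : coprime (h + k) h = coprime k h.
      by rewrite -coprime_modl modnDl coprime_modl.
    have -> // : coprime (h + k) p = coprime k p.
      by have /dvdnP[t tE] := ph; rewrite -coprime_modl tE modnMDl coprime_modl.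
  rewrite mulnDr exprD mulrC; congr (_ * _).
  by rewrite mulnC exprM -qE zetaXn.
apply/eqP; apply: contraT => nz; move: E; rewrite -[X in X = _]mulr1.
move=> /(mulfI nz)/esym/zetaX_eq1 -/(_ p0) pb.
by have := coprime_prime_ndvd pp cob pq; rewrite pb.
Qed.

(** Already the first of the three sums c_j vanishes when v_p(q) exceeds both 1
    and v_p(q1). *)
Lemma sing_lambda_support (R : realType) n q1 q2 q3 a1 a2 a3 q p :
  (0 < q)%N -> (0 < q1)%N -> sing_lambda R n q1 q2 q3 a1 a2 a3 q != 0 ->
  (logn p q <= maxn 1 (logn p q1))%N.
Proof.
move=> q0 q10; apply: contraR; rewrite -ltnNge gtn_max => /andP[l1 l2].
have pp : prime p by move: l1; rewrite lognE; case: (prime p).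
have p0 := prime_gt0 pp.
rewrite sing_lambdaE // /trisum big1 ?mulr0 // => a _.
case: (boolP (coprime a q)) => [coa|_]; last by rewrite mul0r.
rewrite (@charsum_eq0 R q q1 a1 a p) ?mul0r ?mulr0 //.
  by have := pfactor_dvdn 2 pp q0; rewrite l1 => /idP; rewrite expnS expn1.
(* v_p((q,q1)) = v_p(q1) < v_p(q), so p divides q/(q,q1) *)
have /dvdnP[t tE] := dvdn_gcdl q q1.
have t0 : (0 < t)%N by move: q0; rewrite tE muln_gt0 => /andP[].
have : (0 < logn p t)%N.
  have g0 : (0 < gcdn q q1)%N by rewrite gcdn_gt0 q0.
  move: l2; rewrite {1}tE lognM // logn_gcd //.
  by have := geq_minr (logn p q) (logn p q1); lia.
rewrite logn_gt0 mem_primes => /and3P[_ _ /dvdnP[u uE]].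
by rewrite {2}tE uE mulnAC mulnK // dvdn_mull.
Qed.

(** Conjugation replaces b by -b, represented by (q - 1) b. *)
Lemma conj_charsum (R : realType) q s a b : (0 < q)%N ->
  (charsum R q s a b)^* = charsum R q s a (q.-1 * b).
Proof.
move=> q0; rewrite rmorph_sum; apply: eq_bigr => k _.
rewrite rmorphM rmorph_nat; congr (_ * _).
by rewrite -mulnA; apply: conj_zetaX.
Qed.

(** Conjugating b(q) amounts to the substitution a -> -a. *)
Lemma conj_sing_lambda (R : realType) n q1 q2 q3 a1 a2 a3 q : (0 < q)%N ->
  (sing_lambda R n q1 q2 q3 a1 a2 a3 q : R[i])^* =
  sing_lambda R n q1 q2 q3 a1 a2 a3 q.
Proof.
move=> q0; rewrite sing_lambdaE // /weight !rmorphM !fmorphV !rmorph_nat.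
congr (_ * _); rewrite rmorph_sum [RHS](sum_residues_reindex (g := muln q.-1)) //.
- apply: eq_bigr => a _; rewrite !rmorphM rmorph_nat.
  congr (_ * (_ * _ * _ * _)); try exact: conj_charsum.
    by rewrite coprimeMl coprimePn.
  by rewrite fmorphV -mulnA; congr (_^-1); apply: conj_zetaX.
- move=> i j /eqP; rewrite eqn_mod_mul2l ?coprimePn //; exact: eqP.
- move=> k; rewrite coprime_modl !charsum_periodic //.
  by do 2!congr (_ * _); congr (_^-1); apply: zetaX_eq; rewrite ?modnMml.
Qed.

Lemma sing_lambda_real (R : realType) n q1 q2 q3 a1 a2 a3 q : (0 < q)%N ->
  sing_lambda R n q1 q2 q3 a1 a2 a3 q =
  (complex.Re (sing_lambda R n q1 q2 q3 a1 a2 a3 q : R[i]))%:C :> R[i].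
Proof.
move=> q0; have := conj_sing_lambda R n q1 q2 q3 a1 a2 a3 q0.
case: (sing_lambda _ _ _ _ _ _ _ _ _) => x y [] /= yN.
by apply/eqP; rewrite eq_complex /= eqxx /=; apply/eqP; lra.
Qed.

Lemma sum_zeta (R : realType) q k : (0 < q)%N ->
  \sum_(0 <= a < q) zeta R q ^+ (k * a) = (if (q %| k)%N then q%:R else 0).
Proof.
move=> q0; have E a : zeta R q ^+ (k * a) = (zeta R q ^+ k) ^+ a by rewrite exprM.
under eq_bigr do rewrite E; case: ifP => [/dvdnP[t ->]|nqk].
  rewrite mulnC exprM zetaX_order // expr1n.
  by under eq_bigr do rewrite expr1n; rewrite big_const_nat iter_addr_0 subn0.
apply/eqP; have := subrX1 (zeta R q ^+ k) q.
rewrite -exprM mulnC exprM zetaX_order // expr1n subrr big_mkord => /esym/eqP.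
rewrite mulf_eq0 subr_eq0 => /orP[/eqP /zetaX_eq1 - /(_ q0)|//].
by rewrite nqk.
Qed.

(** A prime that does not divide s imposes no congruence, so the sum is that of
    all nontrivial p-th roots of unity. *)
Lemma charsum_prime (R : realType) p s a b : prime p -> ~~ (p %| s)%N ->
  coprime b p -> charsum R p s a b = -1.
Proof.
move=> pp nps cob; have p0 := prime_gt0 pp.
have g1 : gcdn p s = 1%N by apply/eqP; rewrite -/(coprime p s) prime_coprime.
have := sum_zeta R b p0.
have -> : (p %| b)%N = false.
  by apply: negbTE; apply: coprime_prime_ndvd cob _.
rewrite /charsum !(@big_ltn _ _ _ 0 p) // muln0 expr0 => /eqP.
rewrite addrC addr_eq0 => /eqP <-.
rewrite {1}/unit_in_class /coprime gcd0n gtn_eqF ?prime_gt1 // mul0r add0r.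
apply: eq_big_nat => k /andP[k0 kp].
rewrite /unit_in_class g1 !modn1 eqxx andbT coprime_sym prime_coprime // gtnNdvd //.
by rewrite mul1r.
Qed.

Lemma weight_prime (R : realType) p s : prime p -> (0 < s)%N -> ~~ (p %| s)%N ->
  weight R s p = (p.-1)%:R^-1.
Proof.
move=> pp s0 nps; rewrite weightE ?(prime_gt0 pp) //.
have /eqP -> : gcdn s p == 1%N by rewrite gcdnC -/(coprime p s) prime_coprime.
by rewrite (totient_prime pp) totientE // big_nil div1r.
Qed.

(** Each weight is 1/(p-1) and b(p) has p - 1 terms of modulus 1. *)
Lemma norm_sing_lambda_prime (R : realType) n q1 q2 q3 a1 a2 a3 p :
  (0 < q1)%N -> (0 < q2)%N -> (0 < q3)%N ->
  prime p -> ~~ (p %| q1 * q2 * q3)%N ->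
  `|sing_lambda R n q1 q2 q3 a1 a2 a3 p : R[i]| <= (p.-1%:R ^+ 2)^-1.
Proof.
move=> q10 q20 q30 pp; rewrite !Euclid_dvdM // !negb_or => /andP[/andP[n1 n2] n3].
have p0 := prime_gt0 pp; have p1 := prime_gt1 pp.
rewrite sing_lambdaE // !weight_prime //.
have nz : (p.-1)%:R != 0 :> R[i] by rewrite pnatr_eq0 -lt0n -ltnS prednK.
have b_le : `|trisum R n q1 q2 q3 a1 a2 a3 p| <= (p.-1)%:R.
  apply: le_trans (ler_norm_sum _ _ _) _.
  rewrite -totient_prime // totient_count_coprime natr_sum; apply: ler_sum => a _.
  rewrite [coprime p a]coprime_sym normrM normr_nat; case: (boolP (coprime a p)) => co.
    rewrite !charsum_prime // !normrM normfV normrX norm_zeta expr1n invr1 !normrN1.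
    by rewrite !mulr1.
  by rewrite mul0r.
rewrite !normrM !normfV normr_nat.
apply: le_trans (ler_wpM2l _ b_le) _; first by rewrite !mulr_ge0 // invr_ge0.
by rewrite mulfVK // -expr2 exprVn.
Qed.

(** * Divisor sums of the singular series count solutions *)

Lemma eqn_mod_lcm x y s d :
  (x == y %[mod lcmn s d])%N = (x == y %[mod s])%N && (x == y %[mod d])%N.
Proof.
wlog le_yx : x y / (y <= x)%N => [H|].
  case/orP: (leq_total y x) => /H // E.
  by rewrite eq_sym E eq_sym [(y %% d == _)%N]eq_sym.
by rewrite !eqn_mod_dvd // dvdn_lcm.
Qed.

Lemma unit_in_class_dvd Q s a x : (s %| Q)%N ->
  unit_in_class Q s a x = coprime x Q && (x == a %[mod s])%N.
Proof. by rewrite /unit_in_class => /gcdn_idPr ->. Qed.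

(** The two congruences on x are compatible exactly when k = a mod (d,s), and then
    they form one congruence modulo [s,d]. *)
Lemma unit_in_class_count Q s a d k : (0 < Q)%N -> (s %| Q)%N -> (d %| Q)%N ->
  coprime a s ->
  (totient (lcmn s d) * \sum_(0 <= x < Q) (unit_in_class Q s a x && (x == k %[mod d])) =
   unit_in_class d s a k * totient Q)%N.
Proof.
move=> Q0 sQ dQ coas.
have s0 := dvdn_gt0 Q0 sQ; have d0 := dvdn_gt0 Q0 dQ.
case: (boolP (unit_in_class d s a k)) => [/andP[cokd /eqP ka]|nadm].
  have [y [yk ya]] := gcd_chinese_exists d0 s0 ka.
  rewrite mul1n -(@unit_fiber (lcmn s d) Q y) ?dvdn_lcm ?sQ //.
    congr (_ * _)%N; apply: eq_bigr => x _; congr nat_of_bool.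
    by rewrite unit_in_class_dvd // -andbA eqn_mod_lcm ya yk.
  apply: coprime_dvdr (_ : lcmn s d %| s * d)%N _.
    by rewrite dvdn_lcm dvdn_mulr // dvdn_mull.
  rewrite coprimeMr -coprime_modl ya coprime_modl coas /=.
  by rewrite -coprime_modl yk coprime_modl.
rewrite big1 ?muln0 // => x _; rewrite unit_in_class_dvd //.
case: (boolP (_ && _)) => // /andP[/andP[cox /eqP xa] /eqP xk].
case/negP: nadm; apply/andP; split.
  by rewrite -coprime_modl -xk coprime_modl; apply: coprime_dvdr cox.
by rewrite -(modn_dvdm k (dvdn_gcdl d s)) -xk (modn_dvdm _ (dvdn_gcdl d s))
           -(modn_dvdm x (dvdn_gcdr d s)) xa (modn_dvdm _ (dvdn_gcdr d s)).
Qed.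

Lemma weight_dvd (R : realType) s Q : (0 < s)%N -> (0 < Q)%N -> (s %| Q)%N ->
  weight R s Q = (totient s)%:R / (totient Q)%:R.
Proof. by move=> s0 Q0 /gcdn_idPl sQ; rewrite weightE // sQ. Qed.

(** The sum modulo Q evaluated at the fraction b/d only sees the unit x modulo d;
    every class k mod d satisfying the conditions of c_j is hit by
    phi(Q)/phi([s,d]) units. *)
Lemma weight_charsum (R : realType) Q s a d b : (0 < Q)%N -> (s %| Q)%N ->
  (d %| Q)%N -> coprime a s ->
  weight R s d * charsum R d s a b =
  weight R s Q * charsum R Q s a (Q %/ d * b).
Proof.
move=> Q0 sQ dQ coas.
have s0 := dvdn_gt0 Q0 sQ; have d0 := dvdn_gt0 Q0 dQ.
have l0 : (0 < lcmn s d)%N by rewrite lcmn_gt0 s0.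
have h0 : (0 < Q %/ d)%N by rewrite divn_gt0 // dvdn_leq.
have E : (totient (lcmn s d))%:R * charsum R Q s a (Q %/ d * b) =
         (totient Q)%:R * charsum R d s a b.
  have -> : charsum R Q s a (Q %/ d * b) =
    \sum_(0 <= k < d) \sum_(0 <= x < Q)
      (unit_in_class Q s a x && (x == k %[mod d])%N)%:R * zeta R d ^+ (b * k).
    rewrite /charsum exchange_big /=; apply: eq_bigr => x _.
    rewrite (bigD1_seq (x %% d)%N) ?mem_index_iota ?iota_uniq ?ltn_mod //=.
    rewrite modn_mod eqxx andbT big1_seq ?addr0.
      rewrite -mulnA exprM zetaX_div //; congr (_ * _).
      by apply: zetaX_eq; rewrite ?modnMmr.
    move=> z; rewrite mem_index_iota => /andP[zn /= zd].
    by rewrite (modn_small zd) eq_sym (negPf zn) andbF mul0r.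
  rewrite /charsum !big_distrr /=; apply: eq_bigr => k _.
  rewrite -big_distrl /= !mulrA; congr (_ * _).
  rewrite -natr_sum -!natrM unit_in_class_count // mulnC //.
have := totient_neq0 R Q0; have := totient_neq0 R l0; move=> nl nQ.
rewrite (weight_dvd R s0 Q0 sQ) /weight mulrAC; apply: (mulIf nl); rewrite mulfVK //.
apply: (mulIf nQ); rewrite -[LHS]mulrA [charsum _ _ _ _ _ * _]mulrC -E.
by field.
Qed.

Definition sol_count (Q n q1 q2 q3 a1 a2 a3 : nat) : nat :=
  (\sum_(0 <= x < Q) \sum_(0 <= y < Q) \sum_(0 <= z < Q)
     [&& unit_in_class Q q1 a1 x, unit_in_class Q q2 a2 y, unit_in_class Q q3 a3 z &
         x + y + z == n %[mod Q]])%N.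

(** Orthogonality of the additive characters modulo Q. *)
Lemma sum_zeta_div (R : realType) Q u n : (0 < Q)%N ->
  \sum_(0 <= a < Q) zeta R Q ^+ (a * u) / zeta R Q ^+ (a * n) =
  Q%:R * (u == n %[mod Q])%N%:R.
Proof.
move=> Q0; pose w := (u + Q.-1 * n)%N.
have wn : (w + n = u + Q * n)%N.
  by rewrite /w; case: (Q) Q0 => //= m _; ring.
have wE : (Q %| w)%N = (u == n %[mod Q])%N.
  have -> : (u == n %[mod Q])%N = (w + n == n %[mod Q])%N.
    by rewrite wn addnC mulnC modnMDl.
  by rewrite -[X in (_ == X %[mod Q])%N]add0n eqn_modDr mod0n.
rewrite (eq_bigr (fun a => zeta R Q ^+ (w * a))); last first.
  move=> a _; have z0 := zeta_neq0 R Q0.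
  apply: (mulIf (expf_neq0 (a * n) z0)); rewrite mulfVK ?expf_neq0 //.
  rewrite -exprD; apply: zetaX_eq => //.
  have -> : (w * a + a * n = (a * n) * Q + a * u)%N.
    by rewrite [(a * n)%N]mulnC -mulnDl wn; ring.
  by rewrite modnMDl.
by rewrite sum_zeta // wE; case: ifP; rewrite ?mulr1 ?mulr0.
Qed.

Lemma sum_charsum3 (R : realType) Q n q1 q2 q3 a1 a2 a3 : (0 < Q)%N ->
  \sum_(0 <= a < Q) charsum R Q q1 a1 a * charsum R Q q2 a2 a * charsum R Q q3 a3 a
     / zeta R Q ^+ (a * n) =
  Q%:R * (sol_count Q n q1 q2 q3 a1 a2 a3)%:R.
Proof.
move=> Q0.
transitivity (\sum_(0 <= a < Q) \sum_(0 <= x < Q) \sum_(0 <= y < Q)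
  \sum_(0 <= z < Q)
     (unit_in_class Q q1 a1 x &&
      (unit_in_class Q q2 a2 y && unit_in_class Q q3 a3 z))%:R *
     (zeta R Q ^+ (a * (x + y + z)) / zeta R Q ^+ (a * n))).
  apply: eq_bigr => a _; rewrite -!mulrA /charsum big_distrl /=.
  apply: eq_bigr => x _; rewrite mulr_suml mulr_sumr.
  apply: eq_bigr => y _; rewrite mulr_suml !mulr_sumr.
  apply: eq_bigr => z _; rewrite -!mulnb !natrM !mulnDr !exprD; ring.
rewrite exchange_big /= /sol_count natr_sum big_distrr /=.
apply: eq_bigr => x _; rewrite exchange_big /= natr_sum big_distrr /=.
apply: eq_bigr => y _; rewrite exchange_big /= natr_sum big_distrr /=.
apply: eq_bigr => z _; rewrite -big_distrr /= sum_zeta_div //.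
by rewrite -!mulnb !natrM; ring.
Qed.

(** [weight_charsum] brings all terms with d dividing Q to the modulus Q, where
    [sum_by_denominator] assembles them into one sum over all characters. *)
Lemma sum_divisors_sing_lambda (R : realType) Q n q1 q2 q3 a1 a2 a3 :
  (0 < Q)%N -> (q1 %| Q)%N -> (q2 %| Q)%N -> (q3 %| Q)%N ->
  coprime a1 q1 -> coprime a2 q2 -> coprime a3 q3 ->
  \sum_(d <- divisors Q) (sing_lambda R n q1 q2 q3 a1 a2 a3 d : R[i]) =
  ((totient q1 * totient q2 * totient q3)%:R / (totient Q)%:R ^+ 3 *
     (Q * sol_count Q n q1 q2 q3 a1 a2 a3)%:R)%:C.
Proof.
move=> Q0 d1 d2 d3 c1 c2 c3.
have q10 := dvdn_gt0 Q0 d1; have q20 := dvdn_gt0 Q0 d2.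
have q30 := dvdn_gt0 Q0 d3.
transitivity (weight R q1 Q * weight R q2 Q * weight R q3 Q *
   (Q%:R * (sol_count Q n q1 q2 q3 a1 a2 a3)%:R)); last first.
  rewrite !weight_dvd // !natrM !rmorphM fmorphV rmorphXn !rmorph_nat.
  by rewrite -exprVn; ring.
rewrite -sum_charsum3 // sum_by_denominator // big_distrr /=.
apply: eq_big_seq => d; rewrite -dvdn_divisors // => dQ.
have dd0 := dvdn_gt0 Q0 dQ.
rewrite sing_lambdaE // /trisum !big_distrr /= [RHS]big_mkcond /=.
apply: eq_bigr => b _; case: ifP => _; last by rewrite mul0r mulr0.
rewrite mul1r.
have -> : zeta R Q ^+ (Q %/ d * b * n) = zeta R d ^+ (b * n).
  by rewrite -mulnA exprM zetaX_div.
have := weight_charsum R b Q0 d1 dQ c1; have := weight_charsum R b Q0 d2 dQ c2.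
have := weight_charsum R b Q0 d3 dQ c3.
move=> E3 E2 E1.
transitivity (weight R q1 d * charsum R d q1 a1 b * (weight R q2 d * charsum R d q2 a2 b)
  * (weight R q3 d * charsum R d q3 a3 b) / zeta R d ^+ (b * n)); first by ring.
by rewrite E1 E2 E3; ring.
Qed.

Local Open Scope classical_set_scope.

(** * Series with an Euler product *)

(** Adjoining the small primes to Q makes its divisors exhaust, as N grows, the
    support of a function with the properties of [sing_lambda]. *)
Definition saturate (Q N : nat) : nat :=
  (Q * \prod_(0 <= p < N | prime p && ~~ (p %| Q)) p)%N.

Lemma saturate0 Q : saturate Q 0 = Q.
Proof. by rewrite /saturate big_geq // muln1. Qed.

Lemma saturateS Q N : saturate Q N.+1 =
  if prime N && ~~ (N %| Q)%N then (saturate Q N * N)%N else saturate Q N.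
Proof.
rewrite /saturate big_mkcond big_nat_recr //= -big_mkcond /=.
by case: ifP => _; rewrite ?muln1 // mulnA.
Qed.

Lemma saturate_gt0 Q N : (0 < Q)%N -> (0 < saturate Q N)%N.
Proof.
move=> Q0; rewrite muln_gt0 Q0 /=; apply: prodn_cond_gt0 => p /andP[pp _].
exact: prime_gt0.
Qed.

Lemma prime_dvd_saturate Q N p : prime p ->
  (p %| saturate Q N)%N = (p %| Q)%N || (p < N)%N.
Proof.
move=> pp; elim: N => [|N IH].
  by rewrite saturate0 orbF.
rewrite saturateS ltnS leq_eqVlt orbCA -IH.
case: ifP => [/andP[pN nNQ]|H]; first by rewrite Euclid_dvdM // (dvdn_prime2 pp pN) orbC.
case: eqP => //= pN; move: H; rewrite -pN pp /= => /negbFE pQ.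
by rewrite /saturate dvdn_mulr.
Qed.

Lemma prod_nat_recr_cond (R : pzRingType) (P : pred nat) (g : nat -> R) N :
  \prod_(0 <= p < N.+1 | P p) g p =
  (\prod_(0 <= p < N | P p) g p) * (if P N then g N else 1).
Proof. by rewrite big_mkcond big_nat_recr //= -big_mkcond. Qed.

Lemma sum_divisors_saturate (R : realType) (f : nat -> R) Q N :
  (0 < Q)%N ->
  (forall q r, (0 < q)%N -> (0 < r)%N -> coprime q r -> f (q * r)%N = f q * f r) ->
  \sum_(d <- divisors (saturate Q N)) f d =
  (\sum_(d <- divisors Q) f d) *
  \prod_(0 <= p < N | prime p && ~~ (p %| Q)%N) (1 + f p).
Proof.
move=> Q0 fM; elim: N => [|N IH].
  by rewrite big_geq // mulr1 saturate0.
rewrite saturateS prod_nat_recr_cond.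
case: ifP => [/andP[pN nNQ]|_]; last by rewrite mulr1.
rewrite sum_divisors_coprime ?saturate_gt0 //; first by rewrite IH mulrA.
  by rewrite prime_dvd_saturate // ltnn orbF.
move=> d dS; apply: fM; rewrite ?(prime_gt0 pN) //.
  exact: dvdn_gt0 (saturate_gt0 N Q0) dS.
rewrite coprime_sym prime_coprime //; apply: contra nNQ => /dvdn_trans/(_ dS).
by rewrite prime_dvd_saturate // ltnn orbF.
Qed.

(** With k = p - 1, and with k running over all integers >= 2, the factors lie
    between 1 - 1/k^2 and 1 + 1/k^2 <= 1/(1 - 1/k^2), and the product of
    1 - 1/k^2 for 2 <= k <= m + 1 telescopes to (m + 2)/(2(m + 1)). *)
Lemma euler_prod_bounds (R : realType) (g : nat -> R) Q N : (2 %| Q)%N ->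
  (forall p, prime p -> ~~ (p %| Q)%N -> `|g p| <= (p.-1%:R ^+ 2)^-1) ->
  2^-1 <= \prod_(0 <= p < N | prime p && ~~ (p %| Q)%N) (1 + g p) <= 2.
Proof.
move=> Q2 gb; pose P m := \prod_(0 <= p < m | prime p && ~~ (p %| Q)%N) (1 + g p).
have key m : (m.+2)%:R / (2 * (m.+1)%:R) <= P m.+3 <= 2 * (m.+1)%:R / (m.+2)%:R.
  elim: m => [|m /andP[IH1 IH2]].
    rewrite /P big_mkcond !big_nat_recr //= big_geq //= Q2 /=.
    by rewrite !mulr1; lra.
  have -> : P m.+4 = P m.+3 *
      (if prime m.+3 && ~~ (m.+3 %| Q)%N then 1 + g m.+3 else 1).
    by rewrite /P prod_nat_recr_cond.
  have m0 : 0 <= m%:R :> R by rewrite ler0n.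
  set t := (if _ then _ else _).
  have t_bd : 1 - (m.+2%:R ^+ 2)^-1 <= t <= 1 + (m.+2%:R ^+ 2)^-1.
    have v0 : 0 <= (m.+2%:R ^+ 2)^-1 :> R by rewrite invr_ge0 exprn_ge0.
    rewrite /t; case: ifP => [/andP[pp nd]|_].
      have := gb _ pp nd; rewrite [m.+3.-1]/= ler_norml => /andP[g1 g2].
      by rewrite !lerD2l g1 g2.
    by rewrite lerDl v0 gerBl v0.
  have E1 : m.+3%:R / (2 * m.+2%:R) =
     m.+2%:R / (2 * m.+1%:R) * (1 - (m.+2%:R ^+ 2)^-1) :> R.
    by rewrite -!natr1; field; lra.
  have E2 : 2 * m.+1%:R / m.+2%:R * (1 + (m.+2%:R ^+ 2)^-1)
     <= 2 * m.+2%:R / m.+3%:R :> R.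
    rewrite -subr_ge0.
    have -> : 2 * m.+2%:R / m.+3%:R - 2 * m.+1%:R / m.+2%:R * (1 + (m.+2%:R ^+ 2)^-1)
       = 2 / (m.+2%:R ^+ 3 * m.+3%:R) :> R.
      by rewrite -!natr1; field; lra.
    by rewrite divr_ge0 // mulr_ge0 // exprn_ge0.
  have a0 : 0 <= m.+2%:R / (2 * m.+1%:R) :> R by rewrite divr_ge0 // mulr_ge0.
  have b0 : 0 <= 1 - (m.+2%:R ^+ 2)^-1 :> R.
    rewrite subr_ge0 invf_le1 ?exprn_gt0 //.
    by rewrite exprn_ege1 // ler1n.
  move/andP: t_bd => [t1 t2]; apply/andP; split.
    by rewrite E1; apply: ler_pM.
  apply: le_trans E2; apply: ler_pM => //; first exact: le_trans IH1.
  exact: le_trans t1.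
rewrite -/(P N).
case: N => [|[|[|N]]]; rewrite /P.
- by rewrite big_geq //; lra.
- by rewrite big_mkcond big_nat1 /=; lra.
- by rewrite big_mkcond !big_nat_recr //= big_geq //= !mulr1; lra.
rewrite -/(P N.+3); have /andP[k1 k2] := key N.
have N0 : 0 <= N%:R :> R by rewrite ler0n.
have N1 : N.+1%:R = N%:R + 1 :> R by rewrite natr1.
have N2 : N.+2%:R = N%:R + 2 :> R by rewrite -addn2 natrD.
rewrite N1 N2 in k1 k2; apply/andP; split.
  by apply: le_trans k1; rewrite ler_pdivlMr; lra.
by apply: le_trans k2 _; rewrite ler_pdivrMr; lra.
Qed.

Lemma sum_divisors_nat (V : nmodType) (F : nat -> V) M B : (0 < M)%N -> (M < B)%N ->
  \sum_(d <- divisors M) F d = \sum_(0 <= d < B | (d %| M)%N) F d.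
Proof.
move=> M0 MB; rewrite -[RHS]big_filter; apply: perm_big.
apply: uniq_perm; rewrite ?divisors_uniq ?filter_uniq ?iota_uniq // => d.
rewrite mem_filter mem_index_iota -dvdn_divisors //=.
by case: (boolP (d %| M)%N) => //= dM; rewrite (leq_ltn_trans (dvdn_leq M0 dM) MB).
Qed.

Lemma dvdn_saturate Q N q : (0 < Q)%N -> (0 < q)%N -> (q < N)%N ->
  (forall p, prime p -> (logn p q <= maxn 1 (logn p Q))%N) ->
  (q %| saturate Q N)%N.
Proof.
move=> Q0 q0 qN ql; apply/dvdn_partP => // p pq.
have : p \in primes q by exact: pq.
rewrite mem_primes => /and3P[pp _ dpq].
rewrite p_part pfactor_dvdn ?saturate_gt0 //.
apply: leq_trans (ql p pp) _; rewrite geq_max; apply/andP; split.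
  rewrite logn_gt0 mem_primes pp saturate_gt0 //= prime_dvd_saturate //.
  by rewrite (leq_ltn_trans (dvdn_leq q0 dpq) qN) orbT.
by apply: dvdn_leq_log; rewrite ?saturate_gt0 // dvdn_mulr.
Qed.

(** The divisor sums F over saturate Q N are Euler products, and they contain all
    nonzero terms of index < N.  The same holds for the absolute values, whose
    divisor sums H are bounded; this gives absolute convergence, and
    H - T <= limn T - T shows that F and the partial sums have the same limit. *)
Lemma euler_series (R : realType) (f : nat -> R) Q :
  (0 < Q)%N -> (2 %| Q)%N -> f 0%N = 0 ->
  (forall q r, (0 < q)%N -> (0 < r)%N -> coprime q r -> f (q * r)%N = f q * f r) ->
  (forall q p, (0 < q)%N -> f q != 0 -> prime p ->
     (logn p q <= maxn 1 (logn p Q))%N) ->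
  (forall p, prime p -> ~~ (p %| Q)%N -> `|f p| <= (p.-1%:R ^+ 2)^-1) ->
  let G := \sum_(d <- divisors Q) f d in
  exists2 L, series f @ \oo --> L & (G = 0 -> L = 0) /\ (0 < G -> 0 < L).
Proof.
move=> Q0 Q2 f0 fM fs fb G.
pose F N := \sum_(d <- divisors (saturate Q N)) f d.
pose H N := \sum_(d <- divisors (saturate Q N)) `|f d|.
pose T N := \sum_(0 <= d < N) `|f d|.
(* what a divisor sum adds to the partial sum lies beyond N *)
have split_at (g : nat -> R) N : (forall d, f d = 0 -> g d = 0) ->
    \sum_(d <- divisors (saturate Q N)) g d - \sum_(0 <= d < N) g d =
    \sum_(N <= d < (saturate Q N + N).+1 | (d %| saturate Q N)%N) g d.
  move=> g0; rewrite (@sum_divisors_nat _ _ _ (saturate Q N + N).+1) ?saturate_gt0 //;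
    last by rewrite ltnS leq_addr.
  rewrite (big_cat_nat (n := N)) //=; last by rewrite ltnW // ltnS leq_addl.
  have -> : \sum_(0 <= d < N | (d %| saturate Q N)%N) g d = \sum_(0 <= d < N) g d.
    rewrite big_mkcond; apply: eq_big_nat => d /andP[_ dN]; case: ifP => // nd.
    apply/esym/g0/eqP; apply: contraT => fd0.
    have d0 : (0 < d)%N by case: d fd0 {nd dN} => //; rewrite f0 eqxx.
    by rewrite dvdn_saturate // in nd => p; apply: fs.
  by rewrite addrAC subrr add0r.
have FS_le N : `|F N - series f N| <= H N - T N.
  rewrite /F /H /T split_at // (split_at (fun d => `|f d|)) //;
    last by move=> d ->; rewrite normr0.
  exact: ler_norm_sum.
have T_nd : nondecreasing_seq T by apply: nondecreasing_series => *.
have H_le N : H N <= H 0%N * 2.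
  have absM q r : (0 < q)%N -> (0 < r)%N -> coprime q r -> `|f (q * r)%N| = `|f q| * `|f r|.
    by move=> *; rewrite fM // normrM.
  have [|/= _ ub] := andP (@euler_prod_bounds R (fun d => `|f d|) Q N Q2 _).
    by move=> p pp npQ; rewrite normr_id; apply: fb.
  rewrite /H (@sum_divisors_saturate R (fun d => `|f d|) Q N) //.
  by rewrite saturate0; apply: ler_wpM2l ub; apply: sumr_ge0.
have TH N : T N <= H N.
  by rewrite -subr_ge0; apply: le_trans (FS_le N).
have T_cvg : cvgn T.
  apply: nondecreasing_is_cvgn => //; exists (H 0%N * 2) => _ [N _ <-].
  exact: le_trans (TH N) (H_le N).
have H_lim N : H N <= limn T.
  apply: le_trans (nondecreasing_cvgn_le T_nd T_cvg (saturate Q N).+1).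
  rewrite /H (@sum_divisors_nat _ _ _ (saturate Q N).+1) ?saturate_gt0 //.
  by rewrite big_mkcond; apply: ler_sum => d _; case: ifP.
have S_cvg : cvgn (series f) by apply: (@normed_cvg R R^o).
have FSn0 : (fun N => `|F N - series f N|) @ \oo --> (0 : R).
  apply: (@squeeze_cvgr _ _ _ _ (fun=> 0) (fun N => limn T - T N)).
  - by near=> N; rewrite normr_ge0 /=; apply: le_trans (FS_le N) _; rewrite lerB.
  - exact: cvg_cst.
  - by rewrite -(subrr (limn T)); apply: cvgB => //; apply: cvg_cst.
have FS0 : (fun N => F N - series f N) @ \oo --> (0 : R).
  exact/(@norm_cvg0P R R^o).
have F_cvg : F @ \oo --> limn (series f).
  rewrite (_ : F = (fun N => F N - series f N) \+ series f).
    by rewrite -[limn _]add0r; apply: cvgD.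
  by apply/funext => N /=; rewrite subrK.
exists (limn (series f)) => //.
have FE N : F N = G * \prod_(0 <= p < N | prime p && ~~ (p %| Q)%N) (1 + f p).
  exact: sum_divisors_saturate.
split=> [G0|G0].
  have F0 : F = fun=> 0 by apply/funext => N; rewrite FE G0 mul0r.
  by apply/esym; move: F_cvg; rewrite F0 => /(cvg_lim (@Rhausdorff R)) <-; rewrite lim_cst.
apply: (@lt_le_trans _ _ (G / 2)); first by rewrite divr_gt0.
apply: (cvgr_to_ge F_cvg); near=> N.
rewrite FE ler_pM2l //.
by have /andP[] := euler_prod_bounds N Q2 fb.
Unshelve. all: by end_near.
Qed.

(** * The sign of the singular series *)

Lemma cvg_real_complex (R : realType) (u : nat -> R) (L : R) :
  u @ \oo --> L -> (fun n => (u n)%:C : R[i]^o) @ \oo --> (L%:C : R[i]^o).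
Proof.
move=> uL; apply/cvgrPdist_lt => -[e e'] /=.
rewrite ltcE /= => /andP[/eqP -> e0].
have /cvgrPdist_lt /(_ _ e0) := uL.
apply: filterS => n /= un.
rewrite -raddfB /= normc_def /= expr0n addr0 sqrtr_sqr.
by rewrite ltcR.
Qed.

Lemma sing_lambda0 (R : realType) n q1 q2 q3 a1 a2 a3 :
  sing_lambda R n q1 q2 q3 a1 a2 a3 0 = 0.
Proof. by rewrite /sing_lambda /sing_b big_geq // mulr0. Qed.

Lemma dvdn_period q1 q2 q3 (Q := (2 * q1 * q2 * q3)%N) :
  [/\ (2 %| Q)%N, (q1 %| Q)%N, (q2 %| Q)%N & (q3 %| Q)%N].
Proof.
rewrite /Q; split; last exact: dvdn_mull.
- by rewrite -!mulnA dvdn_mulr.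
- by rewrite -mulnA -mulnA mulnCA dvdn_mulr.
- by rewrite -mulnA mulnCA dvdn_mulr.
Qed.

(** Applied to the real function [f] of real parts of lambda, [euler_series]
    evaluates the series, and [sum_divisors_sing_lambda] its divisor sum. *)
Lemma S3_gt0E (R : realType) n q1 q2 q3 a1 a2 a3 (Q := (2 * q1 * q2 * q3)%N) :
  (0 < q1)%N -> (0 < q2)%N -> (0 < q3)%N ->
  coprime a1 q1 -> coprime a2 q2 -> coprime a3 q3 ->
  S3_compatible n q1 q2 q3 a1 a2 a3 ->
  (0 < (S3 R n q1 q2 q3 a1 a2 a3 : R[i])) =
  (0 < sol_count Q n q1 q2 q3 a1 a2 a3)%N.
Proof.
move=> q10 q20 q30 co1 co2 co3 compat.
have Q0 : (0 < Q)%N by rewrite !muln_gt0 q10 q20 q30.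
have [Q2 d1 d2 d3] := dvdn_period q1 q2 q3; rewrite -/Q in Q2 d1 d2 d3.
pose f q : R := complex.Re (sing_lambda R n q1 q2 q3 a1 a2 a3 q : R[i]).
have fE q : sing_lambda R n q1 q2 q3 a1 a2 a3 q = (f q)%:C :> R[i].
  case: q => [|q]; last exact: sing_lambda_real.
  by rewrite /f sing_lambda0.
have f0 : f 0%N = 0 by rewrite /f sing_lambda0.
have fM q r : (0 < q)%N -> (0 < r)%N -> coprime q r -> f (q * r)%N = f q * f r.
  move=> q0 r0 co; apply: (@complexI R); rewrite -fE sing_lambdaM // !fE.
  exact: esym (rmorphM _ _ _).
have fs q p : (0 < q)%N -> f q != 0 -> prime p -> (logn p q <= maxn 1 (logn p Q))%N.
  move=> q0 fq0 pp.
  have /(sing_lambda_support p q0 q10) : sing_lambda R n q1 q2 q3 a1 a2 a3 q != 0.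
    by apply: contra_neq fq0 => l0; rewrite /f l0.
  by have := dvdn_leq_log p Q0 d1; lia.
have fb p : prime p -> ~~ (p %| Q)%N -> `|f p| <= (p.-1%:R ^+ 2)^-1.
  move=> pp npQ; rewrite -lecR.
  have np : ~~ (p %| q1 * q2 * q3)%N.
    by apply: contra npQ => pd; rewrite /Q -!mulnA dvdn_mull // mulnA.
  have := norm_sing_lambda_prime R n a1 a2 a3 q10 q20 q30 pp np.
  by rewrite fE normc_def /= expr0n addr0 sqrtr_sqr fmorphV rmorphXn rmorph_nat.
have [L SL [L0 Lpos]] := euler_series Q0 Q2 f0 fM fs fb.
have S3E : S3 R n q1 q2 q3 a1 a2 a3 = L%:C.
  rewrite /S3 compat; apply: cvg_lim; first exact: norm_hausdorff.
  rewrite (_ : (fun N => _) = (fun N => (series f N)%:C : R[i]^o)).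
    exact: cvg_real_complex.
  apply/funext => -[|N]; first by rewrite /series /= !big_geq.
  rewrite /series /= [in RHS]big_ltn // f0 add0r rmorph_sum /=.
  by apply: eq_bigr => q _; rewrite fE.
rewrite S3E ltcR.
have GE : \sum_(d <- divisors Q) f d =
    (totient q1 * totient q2 * totient q3)%:R / (totient Q)%:R ^+ 3 *
    (Q * sol_count Q n q1 q2 q3 a1 a2 a3)%:R.
  apply: (@complexI R); rewrite -(sum_divisors_sing_lambda R n Q0 d1 d2 d3 co1 co2 co3).
  by rewrite rmorph_sum; apply: eq_bigr => d _; rewrite fE.
case: (posnP (sol_count Q n q1 q2 q3 a1 a2 a3)) => [s0|s0].
  by rewrite L0 ?ltxx // GE s0 muln0 mulr0.
rewrite Lpos // GE mulr_gt0 ?ltr0n ?(muln_gt0 Q) ?Q0 //.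
by rewrite divr_gt0 ?exprn_gt0 // ltr0n ?muln_gt0 !totient_gt0 ?q10 ?q20 ?q30.
Qed.

Lemma sum_nat_gt0_term (F : nat -> nat) Q a : (a < Q)%N -> (0 < F a)%N ->
  (0 < \sum_(0 <= x < Q) F x)%N.
Proof.
move=> aQ Fa; rewrite (bigD1_seq a) ?mem_index_iota ?iota_uniq //=.
exact: ltn_addr.
Qed.

Lemma sol_count_gt0 Q n q1 q2 q3 a1 a2 a3 x y z : (0 < Q)%N ->
  unit_in_class Q q1 a1 x -> unit_in_class Q q2 a2 y ->
  unit_in_class Q q3 a3 z -> (x + y + z = n %[mod Q])%N ->
  (0 < sol_count Q n q1 q2 q3 a1 a2 a3)%N.
Proof.
move=> Q0 cx cy cz e; have w0 w : (w %% Q < Q)%N by rewrite ltn_mod.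
apply: (sum_nat_gt0_term (w0 x)); apply: (sum_nat_gt0_term (w0 y)).
apply: (sum_nat_gt0_term (w0 z)); rewrite !unit_in_class_mod cx cy cz /=.
by rewrite -modnDm modn_mod modnDm -modnDml modnDm modnDml e eqxx.
Qed.

(** Units modulo an even Q are odd, and so is a sum of three of them. *)
Lemma sol_count_even Q n q1 q2 q3 a1 a2 a3 : (2 %| Q)%N -> ~~ odd n ->
  sol_count Q n q1 q2 q3 a1 a2 a3 = 0%N.
Proof.
move=> Q2 evn; rewrite /sol_count big1 // => x _; rewrite big1 // => y _.
rewrite big1 // => z _; apply/eqP; rewrite eqb0; apply/negP.
move=> /and4P[/andP[cx _] /andP[cy _] /andP[cz _] /eqP e].
have co w : coprime w Q -> odd w by rewrite -coprimen2; apply: coprime_dvdr.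
have : (x + y + z = n %[mod 2])%N by rewrite -(modn_dvdm _ Q2) e modn_dvdm.
by rewrite !modn2 !oddD (co x) ?(co y) ?(co z) ?(negPf evn).
Qed.

Theorem lemma1 (R : realType) (n : nat) (hn : (0 < n)%N) :
  (odd n ->
     forall q3 q2 a3 : nat, (0 < q3)%N -> (0 < q2)%N ->
       (a3 < q3)%N -> coprime a3 q3 ->
       exists a2 : nat, admissible_a2 R n q3 a3 q2 a2)
  /\
  (~~ odd n ->
     forall q1 q2 q3 : nat, (0 < q1)%N -> (0 < q2)%N -> (0 < q3)%N ->
       ~ exists a1 a2 a3 : nat, admissible_triplet R n q1 q2 q3 a1 a2 a3).
Proof.
split=> [n_odd q3 q2 a3 q30 q20 a3q3 co3|n_even q1 q2 q3 q10 q20 q30].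
  have [a2 [a2q2 co2 sol]] := odd_unit_solutions n_odd q20 q30 co3.
  exists a2; split=> // q1 q10.
  have [x [y [z [[cox coy coz] [ya za xyz]]]]] := sol q1 q10.
  exists (x %% q1)%N.
  set Q := (2 * q1 * q2 * q3)%N in cox coy coz xyz.
  have Q0 : (0 < Q)%N by rewrite !muln_gt0 q10 q20 q30.
  have [_ d1 d2 d3] := dvdn_period q1 q2 q3; rewrite -/Q in d1 d2 d3.
  have co1 : coprime (x %% q1) q1.
    by rewrite coprime_modl; apply: coprime_dvdr cox.
  have compat : S3_compatible n q1 q2 q3 (x %% q1) a2 a3.
    rewrite /S3_compatible; set g := gcdn _ q3.
    have g3 : (g %| q3)%N := dvdn_gcdr _ _.
    have g12 : (g %| gcdn q1 q2)%N := dvdn_gcdl _ _.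
    have g1 := dvdn_trans g12 (dvdn_gcdl _ _).
    have g2 := dvdn_trans g12 (dvdn_gcdr _ _).
    rewrite -(modn_dvdm n (dvdn_trans g1 d1)) -xyz (modn_dvdm _ (dvdn_trans g1 d1)).
    apply/eqP; rewrite -modnDm -(modnDm x y) -[RHS]modnDm -(modnDm (x %% q1) a2).
    rewrite -(modn_dvdm y g2) -(modn_dvdm z g3) ya za !modn_dvdm //.
  split=> //; first by rewrite ltn_mod.
  rewrite S3_gt0E //.
  apply: (sol_count_gt0 (x := x) (y := y) (z := z)) => //;
    by rewrite unit_in_class_dvd // ?cox ?coy ?coz ?ya ?za ?modn_mod eqxx.
move=> [a1 [a2 [a3 [_ [co1 co2 co3] compat]]]].
rewrite S3_gt0E // sol_count_even //.
by rewrite -!mulnA dvdn_mulr.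
Qed.
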